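(* Let $\Omega\subset\mathbb C^n$ be a domain and let $\varphi$ be a plurisubharmonic function on $\Omega$. Then for almost every point $z\in\Omega$ (with respect to the Lebesgue measure) $\varphi$ allows a differential test from above at $z$.
   Context: Let $\varphi$ be an upper semicontinuous function on a domain $\Omega\subset\mathbb C^n$ and $z\in\Omega$. A function $q$ defined on some neighborhood $V$ of $z$ is called a differential test from above for $\varphi$ at $z$ if $q$ is (real-valued and) $\mathcal C^2$ smooth on $V$ and $\varphi(z)-q(z)=\sup_{w\in V\cap\Omega}(\varphi(w)-q(w))$. The function $\varphi$ is said to allow a differential test from above at $z$ if there exists a neighborhood $V$ of $z$ for which such a $q$ exists. *)

(* Defs.v *)
From HB Require Import structures.
From mathcomp Require Import all_boot all_order all_algebra.
From mathcomp Require Import all_classical all_reals all_analysis.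
From mathcomp Require Import complex.

Set Implicit Arguments.
Unset Strict Implicit.
Unset Printing Implicit Defensive.

Import Order.TTheory GRing.Theory Num.Theory.
Import numFieldNormedType.Exports.

Local Open Scope classical_set_scope.
Local Open Scope ring_scope.

(* The type annotation lets R[i] inherit the topology of a numFieldType (the one
   given by the modulus); 'rV[Cx R]_n then carries the sup norm of the moduli,
   whose topology is the usual one of C^n. *)
Definition Cx (R : realType) : numClosedFieldType := R[i].

Definition cplx (R : realType) (x y : R) : Cx R := (x +i* y)%C.

Notation "''CC[' R ]_ n" := 'rV[Cx R]_n
  (at level 8, n at level 2, format "''CC[' R ]_ n").

(* A function on [D] is represented by a total function of which only the values
   on [D] matter.  Values in [-oo, +oo) are part of the definition. *)
Definition usc_on (T : topologicalType) (R : realType)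
    (D : set T) (f : T -> \bar R) : Prop :=
  (forall z, D z -> (f z < +oo)%E) /\
  (forall z, D z -> forall r : R, (f z < r%:E)%E ->
     \forall w \near z, D w -> (f w < r%:E)%E).

Definition circle_mean (R : realType) (u : Cx R -> \bar R) (c : Cx R) (r : R) :
    \bar R :=
  (((2 * pi)^-1)%:E *
    \int[lebesgue_measure]_(t in `[0%R, (2 * pi)%R])
       u (c + cplx (r * cos t) (r * sin t))%R)%E.

(* The function identically -oo is allowed. *)
Definition subharmonic_on (R : realType) (U : set (Cx R)) (u : Cx R -> \bar R) :
    Prop :=
  usc_on U u /\
  forall (c : Cx R) (r : R), 0 < r ->
    [set w | `|w - c| <= cplx r 0] `<=` U ->
    (u c <= circle_mean u c r)%E.

Definition plurisubharmonic_on (R : realType) (n : nat) (Omega : set 'CC[R]_n)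
    (phi : 'CC[R]_n -> \bar R) : Prop :=
  usc_on Omega phi /\
  forall a b : 'CC[R]_n,
    subharmonic_on [set s : Cx R | Omega (a + s *: b)]
                   (fun s : Cx R => phi (a + s *: b)).

Definition domain (R : realType) (n : nat) (Omega : set 'CC[R]_n) : Prop :=
  [/\ open Omega, connected Omega & Omega !=set0].

Section real_smoothness.
Variables (R : realType) (n : nat).

(* [t |-> w + t v] with [t] real: the real line through [w] in direction [v] in
   C^n = R^(2n).  Directions [v] and ['i *: v] are unrelated. *)
Definition real_line (w v : 'CC[R]_n) (t : R) : 'CC[R]_n := w + cplx t 0 *: v.

Definition real_derivable (q : 'CC[R]_n -> R) (w v : 'CC[R]_n) : Prop :=
  derivable (q \o real_line w v) 0 1.

Definition real_derive (v : 'CC[R]_n) (q : 'CC[R]_n -> R) (w : 'CC[R]_n) : R :=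
  derive1 (q \o real_line w v) 0.

(* C^k smoothness on an open set [V], for the real structure of C^n: [q] and its
   iterated directional derivatives of order at most [k] exist and are
   continuous at every point of [V]. *)
Fixpoint smooth_on (k : nat) (V : set 'CC[R]_n) (q : 'CC[R]_n -> R) : Prop :=
  (forall w, V w -> {for w, continuous q}) /\
  match k with
  | 0 => True
  | k'.+1 => forall v : 'CC[R]_n,
      (forall w, V w -> real_derivable q w v) /\
      smooth_on k' V (real_derive v q)
  end.

End real_smoothness.

Definition differential_test_from_above (R : realType) (n : nat)
    (Omega : set 'CC[R]_n) (phi : 'CC[R]_n -> \bar R) (z : 'CC[R]_n)
    (V : set 'CC[R]_n) (q : 'CC[R]_n -> R) : Prop :=
  smooth_on 2 V q /\
  (phi z - (q z)%:E =
    ereal_sup [set phi w - (q w)%:E | w in V `&` Omega])%E.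

Definition allows_differential_test_from_above (R : realType) (n : nat)
    (Omega : set 'CC[R]_n) (phi : 'CC[R]_n -> \bar R) (z : 'CC[R]_n) : Prop :=
  exists V : set 'CC[R]_n, [/\ open V, V z &
    exists q : 'CC[R]_n -> R, differential_test_from_above Omega phi z V q].

Section lebesgue_tuple.
Variable R : realType.
Let RR := measurableTypeR R.

Definition cons_pair (m : nat) (p : m.-tuple RR * RR) : m.+1.-tuple RR :=
  [tuple of p.2 :: p.1].

Lemma measurable_cons_pair m : measurable_fun setT (@cons_pair m).
Proof. exact: measurable_cons. Qed.

Section lebesgue_cons.
Variables (m : nat) (mu : {measure set (m.-tuple RR) -> \bar R}).

Definition lebesgue_cons : set (m.+1.-tuple RR) -> \bar R :=
  pushforward (mu \x @lebesgue_measure R)%E (@cons_pair m).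

Let mcons := @measurable_cons_pair m.

Let lebesgue_cons0 : lebesgue_cons set0 = 0%E.
Proof. exact: measure0. Qed.

Let lebesgue_cons_ge0 A : (0 <= lebesgue_cons A)%E.
Proof. exact: measure_ge0. Qed.

Let lebesgue_cons_sigma_additive : semi_sigma_additive lebesgue_cons.
Proof. by apply: measure_semi_sigma_additive; exact: mcons. Qed.

HB.instance Definition _ := isMeasure.Build _ _ _ lebesgue_cons
  lebesgue_cons0 lebesgue_cons_ge0 lebesgue_cons_sigma_additive.

End lebesgue_cons.

(* Lebesgue measure on the Borel sets of R^m: the m-fold product of the
   one-dimensional Lebesgue measure. *)
Fixpoint lebesgue_tuple (m : nat) : {measure set (m.-tuple RR) -> \bar R} :=
  match m with
  | 0 => dirac [tuple]
  | m'.+1 => lebesgue_cons (lebesgue_tuple m')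
  end.

End lebesgue_tuple.

(* z_j = t_j + i t_(n+j) *)
Definition of_real_coords (R : realType) (n : nat)
    (t : (n + n).-tuple (measurableTypeR R)) : 'CC[R]_n :=
  \row_(j < n) cplx (tnth t (lshift n j)) (tnth t (rshift n j)).

(* The library's [{ae mu, _}] means that the exceptional set is included in a
   measurable set of measure 0, hence null for the completed measure. *)
Definition almost_every (R : realType) (n : nat) (P : 'CC[R]_n -> Prop) : Prop :=
  {ae lebesgue_tuple R (n + n), forall t, P (of_real_coords t)}.

(* Main.v *)
Require Import Defs.
From mathcomp Require Import all_boot all_order all_algebra.
From mathcomp Require Import all_classical all_reals all_analysis.
From mathcomp Require Import complex.
From mathcomp Require Import ring lra.
Import Order.TTheory GRing.Theory Num.Theory.
Import numFieldNormedType.Exports.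
Local Open Scope classical_set_scope.
Local Open Scope ring_scope.

(** Where phi is identically -oo near a point, any smooth function is a test
    there.  Around the other points the tests are paraboloids pressed onto the
    graph of phi from above.

    Let z be a point with phi z > -oo, and let D be a box centred at z and
    contained in Omega.  Let a be large.  For each y in a much smaller box Y
    around z, the upper semicontinuous function phi - a |. - y|^2 attains its
    maximum over D, at a point x close to z; then a |. - y|^2 is a differential
    test at x.  Call y the vertex of the contact point x.

    The map from contact points to vertices is 16-Lipschitz
    ([contact_lipschitz]).  Let (x0, y0) and (x1, y1) be two contact pairs, and
    put v = y0 - y1.  Subtract from phi the paraboloid of vertex y0, normalized
    so that the difference g vanishes at x0.  Then g <= 0, and the second contact
    gives g w <= 2 a <w - x1, v>.  If v were large compared with x0 - x1, this
    affine function would be very negative on half of the circle of centre x0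
    and radius |v| / 4 in the complex line directed by v, and the mean of phi
    over that circle would be smaller than phi x0.  So plurisubharmonicity gives
    |v|^2 <= 16 <x0 - x1, v>.

    Consequently Y, whose size is a fixed fraction of that of D, is a Lipschitz
    image of the set of contact points, which therefore fills a fixed proportion
    of D.  This holds at every small scale and around points arbitrarily close
    to any point where phi is not locally -oo, so the exceptional set is porous
    in a measure-theoretic sense ([exceptional_porous]).

    Porous sets are null ([porous_negligible]).  Cut a cube Q into a fine grid.
    The cells that meet the set of contact points are at least a proportion
    theta of all cells, because the images of these cells cover Y.  Up to a
    small error the exceptional set is contained in the other cells, and
    applying this again inside each of them makes the covering measure decrease
    geometrically. *)

Set Implicit Arguments.
Unset Strict Implicit.

(** * Grids of cubes and their measure *)

Lemma measure_bigsetU_le (dd : measure_display) (T : measurableType dd) (R : realType)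
    (mu : {measure set T -> \bar R}) (I : Type) (r : seq I) (P : pred I)
    (F : I -> set T) :
  (forall i, P i -> measurable (F i)) ->
  (mu (\big[setU/set0]_(i <- r | P i) F i) <= \sum_(i <- r | P i) mu (F i))%E.
Proof.
move=> mF; elim: r => [|i r IH]; first by rewrite !big_nil measure0.
rewrite !big_cons; case: ifPn => // Pi.
apply: le_trans (leeD2l _ IH).
apply: measureU2; [exact: mF|exact: bigsetU_measurable].
Qed.

Section cubes.
Variables (R : realType) (d : nat).
Implicit Types (c : 'I_d -> R) (l : R) (t x y w : d.-tuple (measurableTypeR R)).

(** Half-open, so that the cells of a grid cover the cube exactly. *)
Definition cube c l : set (d.-tuple (measurableTypeR R)) :=
  [set t | forall i, c i <= (tnth t i : R) < c i + l].

Definition grid_corner c l m (k : {ffun 'I_d -> 'I_m.+1}) (i : 'I_d) : R :=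
  c i + l / m.+1%:R * (k i)%:R.

Lemma cube_grid c l m t : 0 < l -> cube c l t ->
  exists k : {ffun 'I_d -> 'I_m.+1}, cube (grid_corner c l k) (l / m.+1%:R) t.
Proof.
move=> l0 ct; set h := l / m.+1%:R.
have h0 : 0 < h by rewrite divr_gt0.
pose x i := ((tnth t i : R) - c i) / h.
have x0 i : 0 <= x i.
  by apply: divr_ge0; [rewrite subr_ge0; have /andP[] := ct i|exact: ltW].
have xm i : x i < m.+1%:R.
  rewrite ltr_pdivrMr// mulrC divfK ?pnatr_eq0// ltrBlDl.
  by have /andP[] := ct i.
have km i : (Num.truncn (x i) < m.+1)%N.
  have /andP[h1 _] := truncn_itv (x0 i).
  by rewrite -(ltr_nat R) (le_lt_trans h1).
exists [ffun i => Ordinal (km i)] => i; rewrite /grid_corner ffunE /= -/h.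
have /andP[h1 h2] := truncn_itv (x0 i).
have -> : (tnth t i : R) = c i + h * x i.
  by rewrite /x mulrC divfK ?gt_eqF// addrC subrK.
rewrite lerD2l -addrA ltrD2l ler_pM2l// h1/=.
by rewrite -[X in _ + X]mulr1 -mulrDr ltr_pM2l// natr1.
Qed.

Lemma grid_cube c l m (k : {ffun 'I_d -> 'I_m.+1}) : 0 < l ->
  cube (grid_corner c l k) (l / m.+1%:R) `<=` cube c l.
Proof.
move=> l0 t kt i; have := kt i; rewrite /grid_corner.
set h := l / m.+1%:R.
have h0 : 0 < h by rewrite divr_gt0.
move=> /andP[h1 h2]; apply/andP; split.
  by apply: le_trans h1; rewrite lerDl mulr_ge0// ltW.
apply: lt_le_trans h2 _; rewrite -addrA lerD2l.
rewrite -[X in _ + X]mulr1 -mulrDr natr1.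
have -> : l = h * m.+1%:R by rewrite divfK ?pnatr_eq0.
by rewrite ler_pM2l// ler_nat.
Qed.

End cubes.

Lemma cube_measure (R : realType) d (c : 'I_d -> R) (l : R) : 0 <= l ->
  measurable (cube c l) /\ lebesgue_tuple R d (cube c l) = (l ^+ d)%:E.
Proof.
move=> l0; elim: d c => [|d IH] c.
  have -> : cube c l = setT by rewrite -subTset => t _ [].
  by split; [exact: measurableT|rewrite /= diracT].
have mc : measurable (cube c l).
  have -> : cube c l = \bigcap_(i in [set: 'I_d.+1])
     ((fun t : d.+1.-tuple (measurableTypeR R) => tnth t i) @^-1` `[c i, c i + l[).
    apply/seteqP; split=> t ct; first by move=> i _ /=; rewrite in_itv /=; exact: ct.
    by move=> i; have := ct i Logic.I; rewrite /= in_itv.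
  apply: fin_bigcap_measurable => // i _.
  by rewrite -[X in measurable X]setTI; apply: measurable_tnth.
split => //.
have [mc' IHc] := IH (fun i => c (lift ord0 i)).
rewrite /= /lebesgue_cons /pushforward.
have -> : @cons_pair R d @^-1` cube c l =
    cube (fun i => c (lift ord0 i)) l `*` `[c ord0, c ord0 + l[.
  apply/seteqP; split=> -[t x] /=.
    move=> ct; split => [i|/=]; first by have := ct (lift ord0 i); rewrite /cons_pair tnthS.
    by have := ct ord0; rewrite /cons_pair tnth0 in_itv.
  move=> [ct]; rewrite /= in_itv /= => cx i; rewrite /cons_pair.
  case: (unliftP ord0 i) => [j ->|->]; first by rewrite tnthS; exact: ct.
  by rewrite tnth0.
rewrite product_measure1E//.
rewrite [X in (_ * X)%E = _](_ : _ = l%:E); last first.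
  apply: (etrans (lebesgue_measure_itv `[c ord0, c ord0 + l[)).
  rewrite /= lte_fin ltrDl.
  case: ltP => [_|l0']; first by rewrite -EFinD addrAC subrr add0r.
  by congr EFin; apply/eqP; rewrite eq_le l0 l0'.
by rewrite IHc -EFinM exprSr.
Qed.

(** * Porous sets are null *)

Section porosity.
Variables (R : realType) (d : nat).
Implicit Types (N : set (d.-tuple (measurableTypeR R))) (l : R).

(** The invariant of the iteration: [s] is the proportion of every small cube
    that suffices to cover the part of [N] in it. *)
Definition coverable N (l0 s : R) := forall (c : 'I_d -> R) l, 0 < l <= l0 ->
  exists B, [/\ measurable B, N `&` cube c l `<=` B &
    (lebesgue_tuple R d B <= (s * l ^+ d)%:E)%E].

(** [C x y] is to be read as: [y] is the value at [x] of a partial Lipschitz map.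
    Its values fill a subcube of relative size [kappa], so its domain cannot be
    small, and the closure of its domain avoids [N].  With a relation the points
    of the domain need not be matched with values by a choice. *)
Definition porous N (kappa L l0 : R) := forall (c : 'I_d -> R) l, 0 < l <= l0 ->
  exists C : d.-tuple (measurableTypeR R) -> d.-tuple (measurableTypeR R) -> Prop,
  [/\ exists b, forall y, cube b (kappa * l) y -> exists2 x, cube c l x & C x y,
      forall x y x' y' (h : R), C x y -> C x' y' ->
        (forall i, `|(tnth x i : R) - tnth x' i| <= h) ->
        forall i, `|(tnth y i : R) - tnth y' i| <= L * h &
      forall w, (forall e : R, 0 < e -> exists x y, C x y /\
          forall i, `|(tnth x i : R) - tnth w i| < e) -> ~ N w].

(** The cells met by the domain of a Lipschitz map are mapped into cubes of side
    a multiple of the mesh; these cover the range, whose measure bounds from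
    below the number of cells. *)
Lemma grid_count (C : d.-tuple (measurableTypeR R) -> d.-tuple (measurableTypeR R) -> Prop)
    (c b : 'I_d -> R) l (kappa L : R) m (J : {set {ffun 'I_d -> 'I_m.+1}}) :
  0 < l -> 0 < kappa -> 0 < L ->
  (forall y, cube b (kappa * l) y -> exists2 x, cube c l x & C x y) ->
  (forall x y x' y' (h : R), C x y -> C x' y' ->
        (forall i, `|(tnth x i : R) - tnth x' i| <= h) ->
        forall i, `|(tnth y i : R) - tnth y' i| <= L * h) ->
  (forall k, k \in J <-> exists x y, C x y /\ cube (grid_corner c l k) (l / m.+1%:R) x) ->
  (kappa / (3 * L)) ^+ d * (m.+1 ^ d)%:R <= #|J|%:R :> R.
Proof.
move=> l0 k0 L0 Csurj Clip HJ; set h := l / m.+1%:R.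
have h0 : 0 < h by rewrite divr_gt0.
have /choice[f fP] : forall k, exists p : d.-tuple (measurableTypeR R) * d.-tuple (measurableTypeR R),
    k \in J -> C p.1 p.2 /\ cube (grid_corner c l k) h p.1.
  move=> k; case: (boolP (k \in J)) => kJ; last first.
    by exists ([tuple of nseq d (0 : R)], [tuple of nseq d (0 : R)]).
  by have /HJ[x [y xy]] := kJ; exists (x, y).
(* Side 3 L h rather than 2 L h: the closed ball of radius L h has to fit in a
   half-open cube. *)
pose bb k i : R := (tnth (f k).2 i : R) - L * h.
have sub : cube b (kappa * l) `<=` \big[setU/set0]_(k in J) cube (bb k) (3 * (L * h)).
  move=> y /Csurj[x cx Cxy]; have [k kx] := cube_grid m l0 cx.
  have kJ : k \in J by apply/HJ; exists x, y.
  rewrite -bigcup_seq_cond; exists k; first by rewrite /= mem_index_enum.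
  have [Cf kf] := fP _ kJ.
  have xf i : `|(tnth x i : R) - tnth (f k).1 i| <= h.
    have /andP[a1 a2] := kx i; have /andP[a3 a4] := kf i.
    by rewrite ler_distlC; apply/andP; split; rewrite -/h in a1 a2 a3 a4 *; lra.
  move=> i; have := Clip _ _ _ _ _ Cxy Cf xf i; rewrite ler_distlC /bb.
  have : 0 < L * h by rewrite mulr_gt0.
  by move=> ? /andP[? ?]; apply/andP; split; lra.
have Lh0 : 0 <= 3 * (L * h) by rewrite !mulr_ge0// ltW.
have kl0 : 0 <= kappa * l by rewrite mulr_ge0// ltW.
have [mb mub] := cube_measure b kl0.
have : (((kappa * l) ^+ d)%:E <= (#|J|%:R * (3 * (L * h)) ^+ d)%:E)%E.
  rewrite -mub; apply: le_trans (_ : _ <= lebesgue_tuple R d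
    (\big[setU/set0]_(k in J) cube (bb k) (3 * (L * h))))%E _.
    apply: le_measure => //; rewrite inE//; apply: bigsetU_measurable => k _.
    by have [] := cube_measure (bb k) Lh0.
  apply: le_trans (measure_bigsetU_le _ _ _) _.
    by move=> k _; have [] := cube_measure (bb k) Lh0.
  rewrite (eq_bigr (fun=> ((3 * (L * h)) ^+ d)%:E)); last first.
    by move=> k _; have [_ ->] := cube_measure (bb k) Lh0.
  by rewrite sumEFin sumr_const lee_fin -[leLHS]mulr_natl.
rewrite lee_fin => H.
rewrite -(ler_pM2r (_ : 0 < (3 * (L * h)) ^+ d)); last first.
  by rewrite exprn_gt0// !mulr_gt0.
apply: le_trans H; rewrite natrX -!exprMn; rewrite le_eqVlt; apply/orP; left.
apply/eqP; congr (_ ^+ d); rewrite /h; field.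
by rewrite nat1r pnatr_eq0 (gt_eqF L0).
Qed.

Lemma decreasing_measure_small (F : nat -> set (d.-tuple (measurableTypeR R))) (e : R) :
  (forall m, measurable (F m)) -> (forall m, F m.+1 `<=` F m) ->
  (lebesgue_tuple R d (F 0%N) < +oo)%E -> \bigcap_m F m = set0 -> 0 < e ->
  exists m, (lebesgue_tuple R d (F m) <= e%:E)%E.
Proof.
move=> mF dF F0 capF e0.
have cv := nonincreasing_cvg_mu F0 mF.
rewrite capF measure0 in cv.
have {}cv := cv measurable0.
have hF : {homo F : n m / (n <= m)%N >-> (m <= n)%O}.
  apply/nonincreasing_seqP => m; apply/subsetPset; exact: dF.
have {}cv := cv hF.
have : \forall m \near \oo, (lebesgue_tuple R d (F m) < e%:E)%E.
  apply: (cv [set z | (z < e%:E)%E]).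
  by apply: open_nbhs_nbhs; split => /=; [exact: open_ereal_lt_ereal|rewrite lte_fin].
by move=> [m _ /(_ m (leqnn m)) /= /ltW]; exists m.
Qed.

(** A point that lies, for arbitrarily fine grids, in a cell met by the domain of
    [C] is a limit of points of this domain, so it is not in [N].  Hence for a
    fine grid the part of [N] in the met cells is contained in a set of small
    measure.  The other cells, to which the induction hypothesis is applied, are
    at most a proportion [1 - theta] of the cube. *)
Lemma porous_step N (kappa L l0 s : R) : 0 < kappa -> 0 < L -> 0 < s ->
  porous N kappa L l0 -> coverable N l0 s ->
  coverable N l0 ((1 - (kappa / (3 * L)) ^+ d / 2) * s).
Proof.
move=> k0 L0 s0 pN cN c l /andP[l0' ll0].
have [C [[b Csurj] Clip Ccl]] := pN c l (introT andP (conj l0' ll0)).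
set theta := (kappa / (3 * L)) ^+ d.
have th0 : 0 < theta by rewrite exprn_gt0// divr_gt0// mulr_gt0.
pose h m : R := l / m.+1%:R.
have h0 m : 0 < h m by rewrite divr_gt0.
pose J m : {set {ffun 'I_d -> 'I_m.+1}} :=
  finset (fun k => `[< exists x y, C x y /\ cube (grid_corner c l k) (h m) x >]).
have JP m (k : {ffun 'I_d -> 'I_m.+1}) :
    k \in J m <-> exists x y, C x y /\ cube (grid_corner c l k) (h m) x.
  by rewrite inE; split => [/asboolP|] // ?; apply/asboolP.
pose X m := \big[setU/set0]_(k in J m) cube (grid_corner c l k) (h m).
have mX m : measurable (X m).
  by apply: bigsetU_measurable => k _; have [] := cube_measure (grid_corner c l k) (ltW (h0 m)).
have XE m w : X m w -> exists2 k, k \in J m & cube (grid_corner c l k) (h m) w.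
  by rewrite /X -bigcup_seq_cond => -[k /= /andP[_ kJ] kw]; exists k.
(* Grids of different meshes are not nested: W m is the smallest decreasing
   sequence above X m. *)
pose W m := \bigcup_(i in [set i | (m <= i)%N]) X i.
have mW m : measurable (W m) by apply: bigcup_measurable => i _.
pose W' := \bigcap_m W m.
have mW' : measurable W' by exact: bigcap_measurable.
have W'N w : W' w -> ~ N w.
  move=> W'w; apply: Ccl => e e0.
  have [m me] : exists m, h m < e.
    have [m /= lm] : exists m, l / e < m.+1%:R.
      exists (Num.truncn (l / e)); have /andP[_ //] := truncn_itv (ltW (divr_gt0 l0' e0)).
    by exists m; rewrite /h ltr_pdivrMr// mulrC -ltr_pdivrMr.
  have [i /= mi /XE[k kJ kw]] := W'w m Logic.I.
  have [x [y [Cxy kx]]] := (JP _ _).1 kJ.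
  exists x, y; split => // j.
  have hi : h i <= h m by rewrite /h ler_pM2l// lef_pV2 ?posrE// ler_nat.
  have /andP[a1 a2] := kx j; have /andP[a3 a4] := kw j.
  by rewrite ltr_distlC; apply/andP; split; lra.
pose F m := W m `\` W'.
(* Half of the gained proportion is spent on the error W m minus its limit. *)
pose eps := theta / 2 * s * l ^+ d.
have eps0 : 0 < eps by rewrite !mulr_gt0// ?exprn_gt0// invr_gt0.
have [|||||m mF] := @decreasing_measure_small F eps.
- by move=> m; apply: measurableD.
- by move=> m w [[i /= mi Xi] nW]; split => //; exists i => //=; exact: ltnW.
- have [mQ muQ] := cube_measure c (ltW l0').
  apply: (@le_lt_trans _ _ (lebesgue_tuple R d (cube c l))); last by rewrite muQ ltry.
  apply: le_measure; rewrite ?inE//; first exact: measurableD.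
  by move=> w [[i _ /XE[k _]]] kw _; exact: grid_cube kw.
- rewrite -subset0 => w Fw; have [_ nW'] := Fw 0%N Logic.I; apply: nW' => i _.
  by have [] := Fw i Logic.I.
- by [].
have /choice[B BP] : forall k : {ffun 'I_d -> 'I_m.+1}, exists B,
    [/\ measurable B, N `&` cube (grid_corner c l k) (h m) `<=` B &
    (lebesgue_tuple R d B <= (s * h m ^+ d)%:E)%E].
  move=> k; apply: cN; rewrite h0/=; apply: le_trans ll0.
  by rewrite /h ler_pdivrMr// ler_peMr ?ler1n// ltW.
pose U := \big[setU/set0]_(k | k \notin J m) B k.
have mU : measurable U by apply: bigsetU_measurable => k _; have [] := BP k.
exists (U `|` F m); split.
- by apply: measurableU => //; exact: measurableD.
- move=> w [Nw Qw]; have [k kw] := cube_grid m l0' Qw.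
  case: (boolP (k \in J m)) => kJ.
    right; split; last by move=> /W'N.
    exists m => //=; rewrite /X -bigcup_seq_cond; exists k => //=.
    by rewrite mem_index_enum.
  left; rewrite /U -bigcup_seq_cond; exists k; first by rewrite /= mem_index_enum.
  by have [_ + _] := BP k; apply.
apply: le_trans (measureU2 _ mU (measurableD (mW m) mW')) _.
have mu_U : (lebesgue_tuple R d U <= ((1 - theta) * s * l ^+ d)%:E)%E.
  apply: le_trans (measure_bigsetU_le _ _ _) _; first by move=> k _; have [] := BP k.
  apply: (@le_trans _ _ (\sum_(k | k \notin J m) (s * h m ^+ d)%:E)%E).
    by apply: lee_sum => k _; have [] := BP k.
  rewrite sumEFin sumr_const lee_fin -mulr_natl.
  have -> : #|[pred k | k \notin J m]| = #|~: J m| by apply: eq_card => k; rewrite !inE.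
  have cJ : #|J m|%:R + #|~: J m|%:R = (m.+1 ^ d)%:R :> R.
    by rewrite -natrD cardsC card_ffun !card_ord.
  have := grid_count l0' k0 L0 Csurj Clip (JP m); rewrite -/theta => gc.
  have -> : (1 - theta) * s * l ^+ d = (1 - theta) * (m.+1 ^ d)%:R * (s * h m ^+ d).
    have -> : l ^+ d = (m.+1 ^ d)%:R * h m ^+ d.
      by rewrite natrX -exprMn /h mulrC divfK// pnatr_eq0.
    by ring.
  rewrite ler_pM2r; last by rewrite mulr_gt0// exprn_gt0.
  by lra.
apply: le_trans (leeD mu_U mF) _.
by rewrite -EFinD lee_fin /eps; lra.
Qed.

(** The factor gained at each step is the same at all scales, so the proportion
    that has to be covered tends to 0. *)
Lemma porous_cube_negligible N (kappa L l0 : R) c l : 0 < kappa <= 1 -> 1 <= L ->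
  porous N kappa L l0 -> 0 < l <= l0 -> (lebesgue_tuple R d).-negligible (N `&` cube c l).
Proof.
move=> /andP[k0 k1] L1 pN ll0.
have L0 : 0 < L by lra.
set theta := (kappa / (3 * L)) ^+ d.
have th0 : 0 < theta by rewrite exprn_gt0// divr_gt0// mulr_gt0.
have th1 : theta <= 1.
  apply: exprn_ile1; first by rewrite divr_ge0// ltW// mulr_gt0.
  by rewrite ler_pdivrMr ?mulr_gt0//; lra.
pose q := 1 - theta / 2.
have q0 : 0 < q by rewrite /q; lra.
have q1 : `|q| < 1 by rewrite ger0_norm ?ltW// /q; lra.
have cov k : coverable N l0 (q ^+ k).
  elim: k => [|k IH].
    move=> c' l' /andP[l'0 l'1]; have [mQ muQ] := cube_measure c' (ltW l'0).
    by exists (cube c' l'); split => //; rewrite ?expr0 ?mul1r ?muQ// => w [].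
  by rewrite exprS; apply: porous_step => //; exact: exprn_gt0.
have /choice[B BP] := fun k => cov k c l ll0.
have mB : measurable (\bigcap_k B k) by apply: bigcap_measurable => // k _; have [] := BP k.
exists (\bigcap_k B k); split => //; last first.
  by move=> w Nw k _; have [_ + _] := BP k; apply.
apply/eqP; rewrite eq_le measure_ge0 andbT.
apply/lee_addgt0Pr => e e0; rewrite add0e.
have ld0 : 0 < l ^+ d by have /andP[l0' _] := ll0; exact: exprn_gt0.
have [k qk] : exists k, q ^+ k < e / l ^+ d.
  have := cvg_expr q1 => /cvgr0_norm_lt /(_ (e / l ^+ d)).
  rewrite divr_gt0// => /(_ isT)[k _ /(_ k (leqnn k))] /=.
  by rewrite ger0_norm ?exprn_ge0 ?(ltW q0)//; exists k.
have [mBk _ muBk] := BP k.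
apply: (@le_trans _ _ (lebesgue_tuple R d (B k))).
  by apply: le_measure; rewrite ?inE// => w; apply.
by apply: le_trans muBk _; rewrite lee_fin -ler_pdivlMr// ltW.
Qed.

End porosity.

(** A countable union of cubes of side [l0] covers the space. *)
Lemma porous_negligible (R : realType) d (N : set (d.-tuple (measurableTypeR R)))
   (kappa L l0 : R) : 0 < kappa <= 1 -> 1 <= L -> 0 < l0 ->
  porous N kappa L l0 -> (lebesgue_tuple R d).-negligible N.
Proof.
move=> k01 L1 l00 pN.
pose c (k : {ffun 'I_d -> int}) i : R := l0 * (k i)%:~R.
have cov : N `<=` \bigcup_j (if unpickle j is Some k then N `&` cube (c k) l0 else set0).
  move=> t Nt; pose k := [ffun i => Num.floor ((tnth t i : R) / l0)].
  exists (pickle k) => //; rewrite pickleK; split => // i; rewrite /c ffunE.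
  have /andP[a1 a2] := floor_itv ((tnth t i : R) / l0).
  apply/andP; split; first by rewrite mulrC -ler_pdivlMr.
  rewrite -[X in _ + X]mulr1 -mulrDr mulrC -ltr_pdivrMr//.
  by move: a2; rewrite intrD.
apply: negligibleS cov _; apply: negligible_bigcup => j.
case: unpickle => [k|]; last exact: negligible_set0.
by apply: porous_cube_negligible pN _ => //; rewrite l00 lexx.
Qed.

(** * The real structure of C^n *)

Section coordinates.
Variables (R : realType) (n : nat).
Implicit Types (u v w x y : 'CC[R]_n) (i : 'I_(n + n)).

Definition rcoord w i : R :=
  match fintype.split i with
  | inl j => complex.Re (w ord0 j : R[i])
  | inr j => complex.Im (w ord0 j : R[i])
  end.

Lemma rcoord_lshift w (j : 'I_n) : rcoord w (lshift n j) = complex.Re (w ord0 j : R[i]).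
Proof. by rewrite /rcoord (unsplitK (inl j : 'I_n + 'I_n)). Qed.

Lemma rcoord_rshift w (j : 'I_n) : rcoord w (rshift n j) = complex.Im (w ord0 j : R[i]).
Proof. by rewrite /rcoord (unsplitK (inr j : 'I_n + 'I_n)). Qed.

Lemma rcoord_of_real_coords t i : rcoord (of_real_coords t) i = tnth t i.
Proof.
by rewrite -(splitK i); case: (fintype.split i) => j /=;
  rewrite (rcoord_lshift, rcoord_rshift) mxE.
Qed.

Lemma of_real_coords_rcoord w : of_real_coords [tuple rcoord w i | i < n + n] = w.
Proof.
apply/rowP => j; rewrite mxE !tnth_mktuple rcoord_lshift rcoord_rshift.
by rewrite /cplx; case: (w ord0 j).
Qed.

Lemma rcoordD u v i : rcoord (u + v) i = rcoord u i + rcoord v i.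
Proof. by rewrite /rcoord; case: (fintype.split i) => j; rewrite mxE; case: (u _ _); case: (v _ _). Qed.

Lemma rcoordB u v i : rcoord (u - v) i = rcoord u i - rcoord v i.
Proof.
by rewrite /rcoord; case: (fintype.split i) => j; rewrite !mxE; case: (u _ _); case: (v _ _).
Qed.

Lemma rcoordZ (p q : R) v i :
  rcoord (cplx p q *: v) i = p * rcoord v i + q * rcoord (cplx 0 1 *: v) i.
Proof.
rewrite /rcoord; case: (fintype.split i) => j; rewrite !mxE; case: (v _ _) => a b /=; ring.
Qed.

(** The real part of the Hermitian product. *)
Definition rdot u v : R := \sum_i rcoord u i * rcoord v i.

Lemma rdotC u v : rdot u v = rdot v u.
Proof. by apply: eq_bigr => i _; rewrite mulrC. Qed.

Lemma rdotDl u v w : rdot (u + v) w = rdot u w + rdot v w.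
Proof. by rewrite -big_split; apply: eq_bigr => i _; rewrite rcoordD mulrDl. Qed.

Lemma rdotBl u v w : rdot (u - v) w = rdot u w - rdot v w.
Proof. by rewrite -sumrB; apply: eq_bigr => i _; rewrite rcoordB mulrBl. Qed.

Lemma rdotDr u v w : rdot w (u + v) = rdot w u + rdot w v.
Proof. by rewrite rdotC rdotDl !(rdotC w). Qed.

Lemma rdotBr u v w : rdot w (u - v) = rdot w u - rdot w v.
Proof. by rewrite rdotC rdotBl !(rdotC w). Qed.

Lemma rdotZl (p q : R) u v :
  rdot (cplx p q *: u) v = p * rdot u v + q * rdot (cplx 0 1 *: u) v.
Proof.
rewrite /rdot !mulr_sumr -big_split; apply: eq_bigr => i _ /=.
by rewrite rcoordZ mulrDl !mulrA.
Qed.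

Lemma rdotZr (p q : R) u v :
  rdot v (cplx p q *: u) = p * rdot v u + q * rdot v (cplx 0 1 *: u).
Proof. by rewrite rdotC rdotZl !(rdotC v). Qed.

Lemma rdot_ge0 u : 0 <= rdot u u.
Proof. by apply: sumr_ge0 => i _; rewrite -expr2 sqr_ge0. Qed.

(** Multiplication by i is a rotation by a right angle: this is what makes
    [|x0 + s v - y|^2] a trigonometric polynomial on circles. *)
Lemma rdot_rotate u : rdot u (cplx 0 1 *: u) = 0.
Proof.
rewrite /rdot big_split_ord /= -big_split big1 // => j _ /=.
rewrite !rcoord_lshift !rcoord_rshift !mxE; case: (u _ _) => a b /=; ring.
Qed.

Lemma rdot_rotate2 u : rdot (cplx 0 1 *: u) (cplx 0 1 *: u) = rdot u u.
Proof.
rewrite /rdot !big_split_ord /= -!big_split; apply: eq_bigr => j _ /=.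
rewrite !rcoord_lshift !rcoord_rshift !mxE; case: (u _ _) => a b /=; ring.
Qed.

Lemma rdot_le_bound u (h : R) : (forall i, `|rcoord u i| <= h) ->
  rdot u u <= (n + n)%:R * h ^+ 2.
Proof.
move=> uh; apply: (@le_trans _ _ (\sum_(i < n + n) h ^+ 2)).
  apply: ler_sum => i _; rewrite -expr2 -real_normK ?num_real//.
  by rewrite lerXn2r ?nnegrE// (le_trans _ (uh i)).
by rewrite sumr_const card_ord mulr_natl.
Qed.

Lemma sqr_rcoord_le u i : rcoord u i ^+ 2 <= rdot u u.
Proof.
rewrite /rdot (bigD1 i)//= -expr2 lerDl sumr_ge0// => j _.
by rewrite -expr2 sqr_ge0.
Qed.

(** Neighbourhoods in terms of real coordinates: the topology of C^n comes from
    the moduli of the complex entries. *)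
Lemma nbhs_rcoordP w (A : set 'CC[R]_n) : nbhs w A <->
  exists2 e : R, 0 < e & forall x, (forall i, `|rcoord x i - rcoord w i| < e) -> A x.
Proof.
split.
  move=> /nbhs_ballP[e /= e0 eA].
  have [e0' eE] : 0 < complex.Re (e : R[i]) /\ e = cplx (complex.Re (e : R[i])) 0.
    by move: e0; rewrite /cplx; case: (e) => a b; rewrite ltcE /= => /andP[/eqP -> ->].
  exists (complex.Re (e : R[i]) / 2); first by rewrite divr_gt0.
  move=> x xw; apply: eA; split; first by [].
  move=> i j; rewrite (ord1 i) /ball /= eE.
  have := xw (lshift n j); have := xw (rshift n j).
  rewrite !rcoord_lshift !rcoord_rshift.
  case: (w ord0 j) => a b; case: (x ord0 j) => a' b' /=.
  set r := complex.Re _ / 2 => h1 h2.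
  have -> : complex.Re (e : R[i]) = r + r by rewrite /r; lra.
  rewrite normc_def /cplx ltcE /= eqxx /=.
  apply: (@le_lt_trans _ _ (`|a - a'| + `|b - b'|)); last first.
    by rewrite distrC (distrC b) ltrD.
  have ab0 : 0 <= `|a - a'| + `|b - b'| by rewrite addr_ge0.
  rewrite -[leRHS]ger0_norm// -(sqrtr_sqr (`|_| + `|_|)).
  apply: ler_wsqrtr.
  rewrite -(real_normK (num_real (a - a'))) -(real_normK (num_real (b - b'))).
  by rewrite sqrrD lerD2r lerDl mulrn_wge0.
move=> [e e0 eA]; apply/nbhs_ballP; exists (cplx e 0).
  by rewrite /= ltcE /= eqxx.
move=> x [_ xw]; apply: eA => i.
rewrite -(splitK i); case: (fintype.split i) => j /=;
  rewrite (rcoord_lshift, rcoord_rshift) (rcoord_lshift, rcoord_rshift);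
  have := xw ord0 j; rewrite /ball /= normc_def /cplx ltcE /= eqxx /=;
  case: (w ord0 j) => a b; case: (x ord0 j) => a' b' /=; apply: le_lt_trans;
  by rewrite distrC -sqrtr_sqr; apply: ler_wsqrtr; rewrite (lerDl, lerDr) sqr_ge0.
Qed.

End coordinates.

(** * Circle means *)

(** This holds for arbitrary functions, hence for phi on a circle, because the
    integrals of the positive and negative parts are defined as suprema over
    the simple functions below them. *)
Lemma integral_mono (dd : measure_display) (T : measurableType dd) (R : realType)
    (mu : {measure set T -> \bar R}) (D : set T) (f g : T -> \bar R) :
  (forall x, D x -> (f x <= g x)%E) ->
  (\int[mu]_(x in D) f x <= \int[mu]_(x in D) g x)%E.
Proof.
move=> fg; have fgD x : ((f \_ D) x <= (g \_ D) x)%E.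
  by rewrite /patch; case: ifPn => // /set_mem; exact: fg.
rewrite /integral; apply: leeB; apply: le_ereal_sup => _ [h /= hf <-];
  exists h => // x; apply: (le_trans (hf x)).
- by rewrite !funeposE ge_max le_max fgD /= le_max lexx orbT.
- by rewrite !funenegE ge_max le_max leeN2 fgD /= le_max lexx orbT.
Qed.

Lemma integral_trig (R : realType) (k0 k1 k2 k3 : R) :
  (\int[lebesgue_measure]_(t in `[0%R, (2 * pi)%R])
     (k0 + k1 * cos t + k2 * sin t + k3 * cos t ^+ 2)%:E = (2 * pi * k0 + pi * k3)%:E)%E.
Proof.
pose f (t : R) := k0 + k1 * cos t + k2 * sin t + k3 * cos t ^+ 2.
pose F (t : R) := k0 * t + k1 * sin t - k2 * cos t + k3 / 2 * (t + sin t * cos t).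
have dF (t : R) : is_derive t 1 F (f t).
  apply: is_derive_eq.
  rewrite /GRing.scale /=.
  have H : sin t ^+ 2 = 1 - cos t ^+ 2 by rewrite -(cos2Dsin2 t); ring.
  have -> : k3 / 2 * (1 + (sin t * - sin t + cos t * cos t)) =
            k3 / 2 * (1 - sin t ^+ 2 + cos t ^+ 2) by ring.
  by rewrite H /f; field.
have cF : continuous F.
  move=> t; apply: differentiable_continuous; apply/derivable1_diffP.
  by have [] := dF t.
have cf : continuous f.
  move=> t; apply: differentiable_continuous; apply/derivable1_diffP.
  have d : is_derive t 1 f (0 + k1 * (- sin t) + k2 * cos t + k3 * (2 * cos t * - sin t)).
    apply: is_derive_eq.
    by rewrite /GRing.scale /=; ring.
  by have [] := d.
have pi0 : 0 < 2 * pi :> R by rewrite mulr_gt0 ?pi_gt0.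
rewrite (continuous_FTC2 (F := F) pi0).
- rewrite /F sin0 cos0 mulrC -EFinD.
  rewrite mulr2n mulrDl mul1r sinDpi cosDpi sinpi cospi.
  by congr EFin; field.
- exact: continuous_subspaceT.
- split.
  + by move=> t _; have [] := dF t.
  + exact: cvg_at_right_filter (cF _).
  + exact: cvg_at_left_filter (cF _).
- by move=> t _; rewrite derive1E; have [] := dF t.
Qed.

Lemma circle_mean_le_trig (R : realType) (u : Cx R -> \bar R) c (r k0 k1 k2 k3 : R) :
  (forall t, (u (c + cplx (r * cos t) (r * sin t))%R <=
     (k0 + k1 * cos t + k2 * sin t + k3 * cos t ^+ 2)%:E)%E) ->
  (circle_mean u c r <= (k0 + k3 / 2)%:E)%E.
Proof.
move=> uH; rewrite /circle_mean.
have pi0 : 0 < 2 * pi :> R by rewrite mulr_gt0 ?pi_gt0.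
have -> : (k0 + k3 / 2)%:E = ((2 * pi)^-1%:E * (2 * pi * k0 + pi * k3)%:E)%E.
  rewrite -EFinM; congr EFin.
  move: pi0; move: (pi : R) => p; rewrite pmulr_rgt0// => p0.
  by field; exact: lt0r_neq0.
rewrite -(integral_trig k0 k1 k2 k3); apply: lee_wpmul2l.
  by rewrite lee_fin invr_ge0 ltW.
by apply: integral_mono => t _; exact: uH.
Qed.

(** * Contact with paraboloids *)

Section contact.
Variables (R : realType) (n : nat) (phi : 'CC[R]_n -> \bar R).
Implicit Types (w x y : 'CC[R]_n) (D : set 'CC[R]_n) (a : R).

Definition dist2 x y : R := rdot (x - y) (x - y).

(** This is the maximality of [phi - a |. - y|^2] at [x], written so that the
    bound on [phi] is a real number. *)
Definition contact D a y x := D x /\ exists2 f : R, phi x = f%:E &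
  forall w, D w -> (phi w <= (f + a * (dist2 w y - dist2 x y))%:E)%E.

Lemma lee_convex (z : \bar R) (p q th : R) : 0 <= th <= 1 ->
  (z <= p%:E)%E -> (z <= q%:E)%E -> (z <= (p + th * (q - p))%:E)%E.
Proof.
move=> /andP[t0 t1]; case: z => [z| |]; rewrite ?leye_eq ?leNye// !lee_fin => zp zq.
have : (1 - th) * z <= (1 - th) * p by rewrite ler_wpM2l// subr_ge0.
have : th * z <= th * q by rewrite ler_wpM2l.
by lra.
Qed.

Lemma dist2_slope w x1 y0 y1 :
  dist2 w y1 - dist2 x1 y1 - (dist2 w y0 - dist2 x1 y0) = 2 * rdot (w - x1) (y0 - y1).
Proof.
rewrite /dist2 !(rdotBl, rdotBr) (rdotC y1 w) (rdotC y0 w) (rdotC y1 x1) (rdotC y0 x1).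
by ring.
Qed.

Lemma dist2D x y v : dist2 (x + v) y = dist2 x y + 2 * rdot (x - y) v + rdot v v.
Proof.
rewrite /dist2 addrAC; move: (x - y) => u; rewrite rdotDl !rdotDr (rdotC v u).
by ring.
Qed.

Lemma slope_algebra (f0 f1 a X Y Z e : R) : f1 <= f0 + a * (Y - Z) ->
  f1 + a * (X - Y + 2 * e) - (f0 + a * (X - Z)) <= 2 * a * e.
Proof. by lra. Qed.

(** With [v := y0 - y1], [phi] is bounded on the circle [x0 + (1/4) e^(it) v] both
    by the first paraboloid [A] and by the second one [B], and [B - A] is at most
    [2 a <w - x1, v>].  The convex combination of the two bounds with weight
    [(1 - cos t) / 2] favours [B] where this affine function is negative, and it
    is bounded by a trigonometric polynomial, whose mean is explicit.  For a circle
    of parameter [r] the comparison with [phi x0] reads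
    [(r / 2 - r^2) |v|^2 <= <x0 - x1, v>], and [r = 1/4] is the best choice. *)
Lemma contact_monotone Omega D a x0 y0 x1 y1 :
  plurisubharmonic_on Omega phi -> D `<=` Omega -> 0 < a ->
  contact D a y0 x0 -> contact D a y1 x1 ->
  (forall p q : R, p ^+ 2 + q ^+ 2 <= 16^-1 -> D (x0 + cplx p q *: (y0 - y1))) ->
  rdot (y0 - y1) (y0 - y1) <= 16 * rdot (x0 - x1) (y0 - y1).
Proof.
move=> [_ psh] DO a0 [Dx0 [f0 f0E c0]] [Dx1 [f1 f1E c1]] disc.
have /(_ x0 (y0 - y1))[_ /(_ 0 4^-1)] := psh.
rewrite invr_gt0 => /(_ (ltr0n _ _)).
set v := y0 - y1; set nu := rdot v v; set de := rdot (x0 - x1) v.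
pose al := rdot (x0 - y0) v; pose be := rdot (x0 - y0) (cplx 0 1 *: v).
move=> submean.
have /submean : [set w : Cx R | `|w - 0| <= cplx 4^-1 0] `<=`
    [set s : Cx R | Omega (x0 + s *: v)].
  move=> s; rewrite /= subr0 normc_def /cplx lecE /= eqxx /= => s4.
  apply: DO; case: s s4 => p q /= pq; apply: disc.
  have : Num.sqrt (p ^+ 2 + q ^+ 2) ^+ 2 <= 4^-1 ^+ 2.
    by rewrite lerXn2r ?nnegrE ?sqrtr_ge0// invr_ge0.
  rewrite sqr_sqrtr ?addr_ge0 ?sqr_ge0// => h; apply: (le_trans h).
  by rewrite exprVn -natrX.
(* The coefficients of 1, cos, sin and cos^2 in the bound on the circle. *)
pose k0 := f0 + a * nu / 16 + a * de.
pose k1 := a * al / 2 - a * de + a * nu / 4.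
pose k2 := a * be / 2.
pose k3 := - (a * nu / 4).
move=> /le_trans /(_ (@circle_mean_le_trig _ _ _ _ k0 k1 k2 k3 _)).
rewrite /= scale0r addr0 f0E lee_fin => H.
have {}H : f0 <= k0 + k3 / 2.
  apply: H => t; rewrite add0r.
  set C := cos t; set S := sin t.
  have CS : S ^+ 2 = 1 - C ^+ 2 by rewrite -(cos2Dsin2 t) /C /S; ring.
  set sv := cplx _ _ *: v; set w := x0 + sv.
  have Dw : D w.
    apply: disc; rewrite !exprMn CS; lra.
  have th01 : 0 <= (1 - C) / 2 <= 1.
    have := cos_le1 t; have := cos_geN1 t; rewrite -/C => ? ?; apply/andP; split; lra.
  have f1f0 := c0 _ Dx1; rewrite f1E lee_fin in f1f0.
  have dsv u : rdot u sv = 4^-1 * C * rdot u v + 4^-1 * S * rdot u (cplx 0 1 *: v).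
    by rewrite /sv rdotZr.
  have svv : rdot sv v = 4^-1 * C * nu by rewrite rdotC dsv rdot_rotate -/nu; ring.
  have svsv : rdot sv sv = nu / 16.
    rewrite dsv svv /sv rdotZl rdot_rotate rdot_rotate2 -/nu.
    have -> : 4^-1 * C * (4^-1 * C * nu) + 4^-1 * S * (4^-1 * C * 0 + 4^-1 * S * nu) =
      16^-1 * (C ^+ 2 + S ^+ 2) * nu by field.
    by rewrite CS; field.
  have := lee_convex th01 (c0 _ Dw) (c1 _ Dw); move/le_trans; apply; rewrite lee_fin.
  have wy0 : dist2 w y0 - dist2 x0 y0 = (C * al + S * be) / 2 + nu / 16.
    by rewrite dist2D dsv svsv -/al -/be; field.
  have sl : dist2 w y1 - dist2 x1 y1 = dist2 w y0 - dist2 x1 y0 + 2 * (de + 4^-1 * C * nu).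
    have := dist2_slope w x1 y0 y1; rewrite -/v.
    have -> : rdot (w - x1) v = de + 4^-1 * C * nu.
      by rewrite /w rdotBl rdotDl svv /de rdotBl; ring.
    by move/(canRL (subrK _)) ->; rewrite addrC.
  have step : (f1 + a * (dist2 w y1 - dist2 x1 y1)) - (f0 + a * (dist2 w y0 - dist2 x0 y0))
     <= 2 * a * (de + 4^-1 * C * nu).
    by rewrite sl; exact: slope_algebra f1f0.
  have /andP[th0 _] := th01.
  have := ler_wpM2l th0 step => st2.
  apply: le_trans (_ : f0 + a * (dist2 w y0 - dist2 x0 y0) + (1 - C) / 2 * (2 * a * (de + 4^-1 * C * nu)) <= _).
    by rewrite lerD2l.
  rewrite wy0 le_eqVlt; apply/orP; left; apply/eqP.
  by rewrite /k0 /k1 /k2 /k3; field.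
move: H; rewrite /k0 /k3 => H.
have : a * nu <= a * (16 * de) by lra.
by rewrite ler_pM2l.
Qed.

(** From [|v|^2 <= 16 <u, v>] to [|v| <= 16 |u|] by expanding [0 <= |16 u - v|^2]. *)
Lemma contact_lipschitz Omega D a x0 y0 x1 y1 :
  plurisubharmonic_on Omega phi -> D `<=` Omega -> 0 < a ->
  contact D a y0 x0 -> contact D a y1 x1 ->
  (forall p q : R, p ^+ 2 + q ^+ 2 <= 16^-1 -> D (x0 + cplx p q *: (y0 - y1))) ->
  dist2 y0 y1 <= 256 * dist2 x0 x1.
Proof.
move=> psh DO a0 c0 c1 disc; have := contact_monotone psh DO a0 c0 c1 disc.
rewrite /dist2; move: (x0 - x1) (y0 - y1) => u v.
have := rdot_ge0 (cplx 16 0 *: u - v).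
rewrite rdotBl !rdotBr !(rdotZl 16 0) !(rdotZr 16 0) !mul0r !addr0 (rdotC v u).
by lra.
Qed.

End contact.

(** * Existence and limits of contact points *)

(** The superlevel sets [u >= u w] form a filter base on [K], and any cluster
    point of it is a maximum. *)
Lemma usc_max (T : topologicalType) (R : realType) (K : set T) (u : T -> \bar R) :
  compact K -> K !=set0 -> (forall z, K z -> (u z < +oo)%E) ->
  (forall z, K z -> forall r : R, (u z < r%:E)%E ->
     \forall w \near z, K w -> (u w < r%:E)%E) ->
  exists2 x, K x & forall w, K w -> (u w <= u x)%E.
Proof.
move=> cK [k0 Kk0] ufin uusc.
pose B (w : T) := [set x | K x /\ (u w <= u x)%E].
have FF : ProperFilter (filter_from K B).
  apply: filter_from_proper; last by move=> w Kw; exists w; split.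
  apply: filter_from_filter; first by exists k0.
  move=> w1 w2 K1 K2; case: (leP (u w1) (u w2)) => [u12|/ltW u21].
    exists w2 => // x [Kx u2]; split; split => //; exact: le_trans u12 u2.
  by exists w1 => // x [Kx u1]; split; split => //; exact: le_trans u21 u1.
have [|x [Kx clx]] := cK _ FF; first by exists k0 => // x [].
exists x => // w Kw; rewrite leNgt; apply/negP => uxw.
have [r [ur rw]] : exists r : R, (u x < r%:E)%E /\ (r%:E <= u w)%E.
  have := ufin _ Kw; move: uxw; case: (u w) => [b xb _|//|].
    by exists b.
  by rewrite ltNge leNye.
have Bw : filter_from K B (B w) by exists w.
have [y [[Ky uwy] /(_ Ky) uyr]] := clx _ _ Bw (uusc _ Kx r ur).
by have := le_lt_trans (le_trans rw uwy) uyr; rewrite ltxx.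
Qed.

Section box.
Variables (R : realType) (n : nat).
Implicit Types (w x y z : 'CC[R]_n) (l : R).

Definition box z l : set 'CC[R]_n := [set x | forall i, `|rcoord x i - rcoord z i| <= l].

Lemma rcoord_continuous (i : 'I_(n + n)) : continuous (fun x : 'CC[R]_n => rcoord x i).
Proof.
move=> x A /nbhs_ballP[e e0 eA]; apply/nbhs_rcoordP; exists e => // y xy.
by apply: eA; rewrite /ball /= distrC; exact: xy.
Qed.

Lemma rdot_continuous (T : topologicalType) (f g : T -> 'CC[R]_n) :
  continuous f -> continuous g -> continuous (fun t => rdot (f t) (g t)).
Proof.
move=> cf cg t; rewrite /rdot.
apply: (@cvg_big R _ +%R 0 xpredT _ T (nbhs t) (index_enum 'I_(n + n))
  (fun i t => rcoord (f t) i * rcoord (g t) i)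
  (fun i => rcoord (f t) i * rcoord (g t) i)).
  exact: add_continuous.
move=> i _; apply: cvgM => A nA.
  exact: (cf t _ (rcoord_continuous nA)).
exact: (cg t _ (rcoord_continuous nA)).
Qed.

Lemma box_compact z l : compact (box z l).
Proof.
pose f (v : 'rV[R]_(n + n)) : 'CC[R]_n := \row_j cplx (v ord0 (lshift n j)) (v ord0 (rshift n j)).
have fE v i : rcoord (f v) i = v ord0 i.
  by rewrite -(splitK i); case: (fintype.split i) => j /=;
    rewrite (rcoord_lshift, rcoord_rshift) mxE.
have cf : continuous f.
  move=> v A /nbhs_rcoordP[e e0 eA]; apply/nbhs_ballP; exists e => // v' [_ vv'].
  apply: eA => i; rewrite !fE distrC; exact: vv'.
have -> : box z l = f @` [set v : 'rV[R]_(n + n) | forall i, `[rcoord z i - l, rcoord z i + l]%classic (v ord0 i)].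
  apply/seteqP; split => x /=.
    move=> xz; exists (\row_i rcoord x i); last first.
      by rewrite -[RHS]of_real_coords_rcoord; apply/rowP => j; rewrite !mxE !tnth_mktuple.
    by move=> i; rewrite mxE /= in_itv /=; have := xz i; rewrite ler_distl.
  move=> [v vz <-] i; rewrite fE ler_distl.
  by have := vz i; rewrite /= in_itv.
apply: continuous_compact.
  by apply: continuous_subspaceT.
apply: (@rV_compact R (n + n) (fun i => `[rcoord z i - l, rcoord z i + l]%classic)).
by move=> i; exact: segment_compact.
Qed.

End box.

Lemma lte_real_between (R : realType) (u : \bar R) (r : R) : (u < r%:E)%E ->
  exists r', (u < r'%:E)%E /\ r' < r.
Proof.
case: u => [b|//|_]; last by exists (r - 1); rewrite ltNyr ltrBlDr ltrDl.
rewrite lte_fin => br; exists ((b + r) / 2); rewrite lte_fin; split; lra.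
Qed.

Lemma scale_continuous (T : topologicalType) (R : realType) (c : R) (f : T -> R) :
  continuous f -> continuous (fun t => c * f t).
Proof. by move=> cf t; apply: cvgM; [exact: cst_continuous|exact: cf]. Qed.

Lemma affine_continuous (T : topologicalType) (R : realType) (b c : R) (f : T -> R) :
  continuous f -> continuous (fun t => b + c * f t).
Proof.
by move=> cf t; apply: cvgD; [exact: cst_continuous|exact: scale_continuous].
Qed.

Lemma near_pair_gt (T1 T2 : topologicalType) (R : realType) (F : T1 * T2 -> R)
    (x : T1) (y : T2) (r : R) : continuous F -> r < F (x, y) ->
  exists A B, [/\ nbhs x A, nbhs y B & forall x' y', A x' -> B y' -> r < F (x', y')].
Proof.
move=> cF rF; have [[A B] /= [xA yB] AB] := cvgr_gt _ (cF (x, y)) _ rF.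
by exists A, B; split => // x' y' Ax' By'; exact: AB (x', y') (conj Ax' By').
Qed.

Section touching.
Variables (R : realType) (n : nat) (Omega : set 'CC[R]_n) (phi : 'CC[R]_n -> \bar R).
Hypothesis phi_usc : usc_on Omega phi.
Implicit Types (w x y z : 'CC[R]_n) (a l : R).

Lemma rowB_continuous (T : topologicalType) (f g : T -> 'CC[R]_n) :
  continuous f -> continuous g -> continuous (fun t => f t - g t).
Proof. by move=> cf cg t; apply: cvgB; [exact: cf|exact: cg]. Qed.

Lemma dist2_continuous (T : topologicalType) (f g : T -> 'CC[R]_n) :
  continuous f -> continuous g -> continuous (fun t => dist2 (f t) (g t)).
Proof.
by move=> cf cg; apply: rdot_continuous; exact: rowB_continuous.
Qed.

Lemma box_center z l : 0 <= l -> box z l z.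
Proof. by move=> l0 i; rewrite subrr normr0. Qed.

Lemma contact_exists z l a y : 0 <= l -> box z l `<=` Omega -> (-oo < phi z)%E ->
  exists x, contact phi (box z l) a y x.
Proof.
move=> l0 DO phiz; have [ufin uusc] := phi_usc.
have cd : continuous (fun w : 'CC[R]_n => dist2 w y).
  by apply: dist2_continuous => t; [by move=> A|exact: cst_continuous].
pose u w := (phi w + (- (a * dist2 w y))%:E)%E.
have [|w Dw|w Dw r uwr|x Dx xmax] := @usc_max _ R (box z l) u (@box_compact _ _ z l).
- by exists z; exact: box_center.
- by rewrite /u lte_add_pinfty ?ltry// ufin//; exact: DO.
- have : (phi w < (r + a * dist2 w y)%:E)%E.
    by move: uwr; rewrite /u EFinN lteBlDr// -EFinD.
  move=> /lte_real_between[r' [pr r'r]].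
  have nr : \forall t \near w, r' < r + a * dist2 t y.
    exact: (cvgr_gt _ (@affine_continuous _ _ r a _ cd w) _ r'r).
  apply: filterS2 (uusc _ (DO _ Dw) _ pr) nr => t ht r't Dt.
  rewrite /u EFinN lteBlDr// -EFinD; apply: lt_trans (ht (DO _ Dt)) _.
  by rewrite lte_fin.
exists x; split => //.
have := ufin _ (DO _ Dx); have := xmax _ (box_center z l0).
move: xmax; rewrite /u; case: (phi x) => [f xmax _ _|//|]; last first.
  by move=> _; move: phiz; case: (phi z).
exists f => // w Dw; have := xmax _ Dw.
rewrite EFinN leeBlDr// -!EFinD; congr (_ <= _)%E; congr EFin; lra.
Qed.

(** The vertices of a sequence of contact points converging to [w] cluster at some
    [y], and the contact inequality passes to the limit because [phi] is upper
    semicontinuous at [w].  The finiteness of [phi w] comes from comparison with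
    the value at the centre of the box. *)
Lemma contact_limit z l a (Y : set 'CC[R]_n) w : 0 <= l -> box z l `<=` Omega ->
  (-oo < phi z)%E -> 0 < a -> compact Y ->
  (forall e : R, 0 < e -> exists x y,
     [/\ Y y, contact phi (box z l) a y x & forall i, `|rcoord x i - rcoord w i| < e]) ->
  exists2 y, Y y & contact phi (box z l) a y w.
Proof.
move=> l0 DO phiz a0 cY lim; have [ufin uusc] := phi_usc.
have Dw : box z l w.
  move=> i; apply/ler_addgt0Pr => e e0.
  have [x [y [_ [Dx _] xw]]] := lim _ e0.
  have -> : rcoord w i - rcoord z i = (rcoord w i - rcoord x i) + (rcoord x i - rcoord z i) by ring.
  rewrite (le_trans (ler_normD _ _))// addrC lerD//; last by rewrite distrC ltW.
pose B (e : R) := [set y | Y y /\ exists x, contact phi (box z l) a y x /\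
  forall i, `|rcoord x i - rcoord w i| < e].
have FF : ProperFilter (filter_from [set e : R | 0 < e] B).
  apply: filter_from_proper; last first.
    by move=> e /= e0; have [x [y [Yy xy xw]]] := lim _ e0; exists y; split => //; exists x.
  apply: filter_from_filter; first by exists 1 => /=.
  move=> e1 e2 /= e10 e20; exists (Num.min e1 e2); first by rewrite /= lt_min e10.
  move=> y [Yy [x [xy xw]]]; split; split => //; exists x; split => // i;
    by have := xw i; rewrite lt_min => /andP[].
have [|y [Yy cly]] := cY _ FF; first by exists 1 => //= y [].
exists y => //; split => //.
have main v (b : R) : box z l v -> phi v = b%:E ->
    ((b + a * (dist2 w y - dist2 v y))%:E <= phi w)%E.
  move=> Dv phiv; rewrite leNgt; apply/negP => /lte_real_between[r [pr rb]].
  pose F (p : 'CC[R]_n * 'CC[R]_n) : R := b + a * (dist2 p.1 p.2 - dist2 v p.2).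
  have cF : continuous F.
    apply: affine_continuous => p.
    apply: cvgB.
      by apply: dist2_continuous => t; [exact: cvg_fst|exact: cvg_snd].
    by apply: dist2_continuous => t; [exact: cst_continuous|exact: cvg_snd].
  have [A1 [A2 [wA1 yA2 A12]]] := @near_pair_gt _ _ _ F w y r cF rb.
  have [e e0 eA] := (nbhs_rcoordP _ _).1 (filterI wA1 (uusc _ (DO _ Dw) _ pr)).
  have Be : filter_from [set e : R | 0 < e] B (B e) by exists e.
  have [y' [[Yy' [x [[Dx [f xf cx]] xw]]] A2y']] := cly _ _ Be yA2.
  have [A1x /(_ (DO _ Dx))] := eA _ xw.
  rewrite xf lte_fin => fr.
  have := A12 _ _ A1x A2y'; rewrite /F /=.
  have := cx _ Dv; rewrite phiv lee_fin; lra.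
have [b phizb] : exists b, phi z = b%:E.
  move: phiz (ufin _ (DO _ (box_center z l0))).
  by case: (phi z) => [b _ _|//|//]; exists b.
have := main _ _ (box_center z l0) phizb.
have := ufin _ (DO _ Dw).
case E : (phi w) => [f|//|//] _ _; exists f => // v Dv.
have := ufin _ (DO _ Dv); case E' : (phi v) => [c|//|] _; last by rewrite leNye.
by have := main _ _ Dv E'; rewrite E !lee_fin; lra.
Qed.

Lemma is_derive_quadratic (c0 c1 c2 : R) :
  is_derive (0 : R) 1 (fun t : R => c0 + t * c1 + t ^+ 2 * c2) c1.
Proof. by apply: is_derive_eq; rewrite /GRing.scale /=; ring. Qed.

(** Along a real line a paraboloid is a quadratic polynomial, its derivative is
    affine in the base point, and the second derivative is constant. *)
Lemma paraboloid_smooth a y (V : set 'CC[R]_n) : smooth_on 2 V (fun w => a * dist2 w y).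
Proof.
have lin u (v : 'CC[R]_n) (t : R) : rdot u (cplx t 0 *: v) = t * rdot u v.
  by rewrite rdotZr mul0r addr0.
have linl u (v : 'CC[R]_n) (t : R) : rdot (cplx t 0 *: v) u = t * rdot v u.
  by rewrite rdotC lin rdotC.
have dq v w : is_derive (0 : R) 1 ((fun w => a * dist2 w y) \o real_line w v)
    (2 * a * rdot (w - y) v).
  have -> : (fun w => a * dist2 w y) \o real_line w v =
     fun t : R => a * dist2 w y + t * (2 * a * rdot (w - y) v) + t ^+ 2 * (a * rdot v v).
    apply/funext => t; rewrite /real_line /= dist2D lin lin linl; ring.
  exact: is_derive_quadratic.
have dl v v' w : is_derive (0 : R) 1 ((fun w => 2 * a * rdot (w - y) v) \o real_line w v')
    (2 * a * rdot v' v).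
  have -> : (fun w => 2 * a * rdot (w - y) v) \o real_line w v' =
     fun t : R => 2 * a * rdot (w - y) v + t * (2 * a * rdot v' v) + t ^+ 2 * 0.
    apply/funext => t; rewrite /real_line /= (addrAC w) (rdotDl (w - y)) linl; ring.
  exact: is_derive_quadratic.
have cd : continuous (fun w : 'CC[R]_n => dist2 w y).
  by apply: dist2_continuous => t; [by move=> A|exact: cst_continuous].
split.
  by move=> w _; exact: (@scale_continuous _ _ a _ cd w).
move=> v; split.
  by move=> w _; have [] := dq v w.
have -> : real_derive v (fun w => a * dist2 w y) = fun w => 2 * a * rdot (w - y) v.
  by apply/funext => w; rewrite /real_derive derive1E; have [] := dq v w.
have cl : continuous (fun w : 'CC[R]_n => 2 * a * rdot (w - y) v).
  move=> w; have crd : continuous (fun w : 'CC[R]_n => rdot (w - y) v).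
    apply: rdot_continuous => t; last exact: cst_continuous.
    by apply: rowB_continuous => u; [by move=> A|exact: cst_continuous].
  exact: (@scale_continuous _ _ (2 * a) _ crd w).
split; first by move=> w _; exact: cl.
move=> v'; split.
  by move=> w _; have [] := dl v v' w.
have -> : real_derive v' (fun w => 2 * a * rdot (w - y) v) = fun w => 2 * a * rdot v' v.
  by apply/funext => w; rewrite /real_derive derive1E; have [] := dl v v' w.
split; last by [].
by move=> w _; apply: (@cst_continuous 'CC[R]_n R (2 * a * rdot v' v)).
Qed.

(** The test is restricted to the interior of the box, where the contact point
    lies. *)
Lemma contact_allows z l r a y w : box z l `<=` Omega -> r < l -> box z r w ->
  contact phi (box z l) a y w ->
  allows_differential_test_from_above Omega phi w.
Proof.
move=> DO rl rw [Dw [f fE cw]].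
have VD s : s < l -> box z s `<=` box z l.
  by move=> sl x zx i; apply: le_trans (zx i) (ltW sl).
exists (\bigcup_(s in [set s | s < l]) box z s); split.
- rewrite openE => x [s /= sl zx]; apply/nbhs_rcoordP; exists ((l - s) / 2).
    by rewrite divr_gt0// subr_gt0.
  move=> x' xx'; exists ((l + s) / 2) => /=; first lra.
  move=> i; have -> : rcoord x' i - rcoord z i =
    (rcoord x' i - rcoord x i) + (rcoord x i - rcoord z i) by ring.
  apply: (le_trans (ler_normD _ _)); have := zx i; have := xx' i; lra.
- by exists r.
exists (fun w => a * dist2 w y); split; first exact: paraboloid_smooth.
apply/eqP; rewrite eq_le; apply/andP; split.
  apply: ereal_sup_ubound; exists w => //; split; last exact: DO.
  by exists r.
apply: ge_ereal_sup => _ [x [[s /= sl zx] _] <-].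
rewrite fE !EFinN leeBlDr// -EFinB -EFinD; apply: le_trans (cw _ (VD _ sl _ zx)) _.
by rewrite lee_fin; lra.
Qed.

Lemma allows_of_locally_ninfty w : Omega w -> (\forall x \near w, phi x = -oo%E) ->
  allows_differential_test_from_above Omega phi w.
Proof.
move=> Ow nw; have /nbhs_interior nw' := nw.
exists [set x | phi x = -oo%E]^°; split; [exact: open_interior|exact: nbhs_singleton nw'|].
exists (fun x => 0 * dist2 x w); split; first exact: paraboloid_smooth.
have phiw : phi w = -oo%E := nbhs_singleton nw.
rewrite phiw addNye; apply/esym/eqP; rewrite -leeNy_eq.
apply: ge_ereal_sup => _ [x [xV _] <-].
have -> : phi x = -oo%E := interior_subset xV.
by rewrite addNye.
Qed.

End touching.

(** * The exceptional set is porous *)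

Section assembly.
Variables (R : realType) (n : nat) (Omega : set 'CC[R]_n) (phi : 'CC[R]_n -> \bar R).
Hypothesis phi_psh : plurisubharmonic_on Omega phi.
Implicit Types (z x y : 'CC[R]_n) (a l : R).
Let d := (n + n)%N.

Lemma rdotZZ (p q : R) (v : 'CC[R]_n) :
  rdot (cplx p q *: v) (cplx p q *: v) = (p ^+ 2 + q ^+ 2) * rdot v v.
Proof.
rewrite rdotZl (rdotZr _ _ _ v) rdot_rotate (rdotZr _ _ _ (cplx 0 1 *: v)).
by rewrite (rdotC (cplx 0 1 *: v) v) rdot_rotate rdot_rotate2; ring.
Qed.

Lemma ler_abs_sqr (u b : R) : 0 <= b -> u ^+ 2 <= b ^+ 2 -> `|u| <= b.
Proof. by move=> b0 ub; rewrite -ler_sqr ?nnegrE// real_normK ?num_real. Qed.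

Lemma box_dist2 z (r : R) x y : box z r x -> box z r y -> dist2 x y <= d%:R * (2 * r) ^+ 2.
Proof.
move=> zx zy; apply: rdot_le_bound => i; rewrite rcoordB.
have -> : rcoord x i - rcoord y i = (rcoord x i - rcoord z i) - (rcoord y i - rcoord z i) by ring.
by apply: (le_trans (ler_normB _ _)); have := zx i; have := zy i; lra.
Qed.

Lemma natr_le_sqr_succ m (s : R) : 0 <= s -> m%:R * s <= m.+1%:R * (m.+1%:R * s).
Proof.
move=> s0; apply: (@le_trans _ _ (m.+1%:R * s)).
  by rewrite ler_wpM2r// ler_nat.
by rewrite ler_peMl ?ler1n// mulr_ge0.
Qed.

(** A steep paraboloid that touches [phi] far from [z], at a height bounded by the
    maximum [M] of [phi] on the box, and whose vertex is close to [z], would pass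
    below [phi z] at [z]. *)
Lemma contact_localized z l : 0 < l -> box z l `<=` Omega -> (-oo < phi z)%E ->
  exists2 a : R, 0 < a & forall x y, box z (l / (16 * d.+1%:R)) y ->
    contact phi (box z l) a y x -> box z (l / 4) x.
Proof.
move=> l0 DO phiz; have [[ufin uusc] _] := phi_psh.
have [||w Dw|w Dw r wr|xm Dxm xmax] := @usc_max _ R (box z l) phi _.
- exact: box_compact.
- by exists z; apply: box_center; exact: ltW.
- by apply: ufin; exact: DO.
- by apply: filterS (uusc _ (DO _ Dw) _ wr) => t tr Dt; exact: tr (DO _ Dt).
have zm := xmax _ (box_center z (ltW l0)).
have [f0 phizE] : exists f0, phi z = f0%:E.
  move: phiz (ufin _ (DO _ (box_center z (ltW l0)))).
  by case: (phi z) => [b _ _|//|//]; exists b.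
have [M phiM] : exists M, phi xm = M%:E.
  move: zm (ufin _ (DO _ Dxm)); rewrite phizE.
  by case: (phi xm) => [b _ _|//|//]; exists b.
have f0M : f0 <= M by move: zm; rewrite phizE phiM lee_fin.
set rho := l / (16 * d.+1%:R).
have d1 : 1 <= d.+1%:R :> R by rewrite ler1n.
have rho0 : 0 < rho by rewrite divr_gt0// mulr_gt0.
have rhol : d.+1%:R * (16 * rho) = l.
  by rewrite /rho; move: d1; move: (d.+1%:R : R) => D D1; field; rewrite gt_eqF//; lra.
have rho16 : 16 * rho <= l by rewrite -rhol ler_peMl// mulr_ge0// ltW.
(* Outside the box of radius l / 4 the paraboloid is larger than at z by
   at least a * (9 - 1) * l ^+ 2 / 256 = M - f0 + 1. *)
pose a := 32 * (M - f0 + 1) / l ^+ 2.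
have l20 : 0 < l ^+ 2 by rewrite exprn_gt0.
have a0 : 0 < a by rewrite divr_gt0// mulr_gt0//; lra.
exists a => // x y Yy [Dx [f fE cx]] i; rewrite leNgt; apply/negP => xi.
have fM : f <= M by have := xmax _ Dx; rewrite fE phiM lee_fin.
have := cx _ (box_center z (ltW l0)); rewrite phizE lee_fin => ineq.
have dz : dist2 z y <= l ^+ 2 / 256.
  have : dist2 z y <= d%:R * rho ^+ 2.
    apply: rdot_le_bound => j; rewrite rcoordB distrC; exact: Yy.
  have := natr_le_sqr_succ d (sqr_ge0 rho).
  by rewrite -rhol; move: (d.+1%:R : R) => D; lra.
have dx : 9 * l ^+ 2 / 256 <= dist2 x y.
  apply: le_trans (sqr_rcoord_le (x - y) i); rewrite rcoordB.
  have h : 3 * l / 16 <= `|rcoord x i - rcoord y i|.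
    have := ler_normD (rcoord x i - rcoord y i) (rcoord y i - rcoord z i).
    have -> : rcoord x i - rcoord y i + (rcoord y i - rcoord z i) = rcoord x i - rcoord z i by ring.
    by have := Yy i; rewrite -/rho; lra.
  rewrite -(real_normK (num_real (rcoord x i - rcoord y i))).
  have -> : 9 * l ^+ 2 / 256 = (3 * l / 16) ^+ 2 by field.
  by rewrite ler_pXn2r// nnegrE; lra.
have : a * (dist2 z y - dist2 x y) <= a * (- (l ^+ 2 / 32)).
  by rewrite ler_pM2l//; lra.
have -> : a * (- (l ^+ 2 / 32)) = - (M - f0 + 1).
  by rewrite /a; move: l20; move: (l ^+ 2) => L2 L20; field; rewrite gt_eqF.
by lra.
Qed.

(** The radius [k.+1%:R^-1] makes the scale below which the boxes used stay in
    [Omega] uniform; the union over [k] is the whole exceptional set. *)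
Definition exceptional (k : nat) : set (d.-tuple (measurableTypeR R)) :=
  [set t | [/\ Omega (of_real_coords t),
    ~ allows_differential_test_from_above Omega phi (of_real_coords t) &
    box (of_real_coords t) k.+1%:R^-1 `<=` Omega]].

(** If the set misses the middle of the cube, the identity on a smaller cube in
    the middle serves as the Lipschitz map.  Otherwise there is a point of
    the middle where [phi] is not locally -oo, hence a nearby [z] with [phi z]
    finite, and the map from contact points to vertices serves. *)
Lemma exceptional_porous k :
  porous (exceptional k) (8 * d.+1%:R)^-1 (16 * d.+1%:R) (k.+1%:R^-1 / 2).
Proof.
move=> c l /andP[l0 lk].
have d1 : 1 <= d.+1%:R :> R by rewrite ler1n.
have kap : (8 * d.+1%:R)^-1 <= 8^-1 :> R.
  by rewrite lef_pV2 ?posrE ?mulr_gt0//; lra.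
have [[t0 [[Ot0 nt0 bt0] mt0]]|none] := pselect (exists t, exceptional k t /\
    forall i, c i + 3 * l / 8 <= (tnth t i : R) <= c i + 5 * l / 8); last first.
  exists (fun x y : d.-tuple (measurableTypeR R) => x = y /\ forall i, c i + 7 * l / 16 <= (tnth x i : R) <= c i + 9 * l / 16).
  split.
  - exists (fun i => c i + 7 * l / 16) => y yb.
    have kl : (8 * d.+1%:R)^-1 * l <= 8^-1 * l by rewrite ler_pM2r.
    move: yb kl; move: (_^-1 * l) => K yb kl.
    by exists y; [|split => //] => i; have /= /andP[? ?] := yb i; apply/andP; split; lra.
  - move=> x _ x' _ h [<- _] [<- _] xh i; apply: le_trans (xh i) _.
    have h0 : 0 <= h := le_trans (normr_ge0 _) (xh i).
    by rewrite ler_peMl//; move: d1; move: (d.+1%:R : R) => D; lra.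
  - move=> w lim Nw; apply: none; exists w; split => // i.
    have l16 : 0 < l / 16 by rewrite divr_gt0.
    have [x [y [[_ xm] xw]]] := lim _ l16.
    have := xw i; rewrite ltr_distl => /andP[? ?]; have /andP[? ?] := xm i.
    by apply/andP; split; lra.
set w0 := of_real_coords t0 in Ot0 nt0 bt0.
have [z [zw phiz]] : exists z, (forall i, `|rcoord z i - rcoord w0 i| < l / 8) /\ (-oo < phi z)%E.
  apply: contrapT => nz; apply: nt0; apply: allows_of_locally_ninfty => //.
  apply/nbhs_rcoordP; exists (l / 8); first by rewrite divr_gt0.
  move=> x xw; apply: contrapT => /eqP phix; apply: nz; exists x; split => //.
  by rewrite ltNye.
have DO : box z l `<=` Omega.
  apply: subset_trans bt0 => x zx i.
  have -> : rcoord x i - rcoord w0 i = (rcoord x i - rcoord z i) + (rcoord z i - rcoord w0 i) by ring.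
  apply: (le_trans (ler_normD _ _)); have := zx i; have := zw i.
  by move: lk; move: (k.+1%:R^-1 : R) => K; lra.
have zc i : c i + l / 4 < rcoord z i < c i + 3 * l / 4.
  have := zw i; rewrite rcoord_of_real_coords ltr_distl => /andP[? ?].
  by have /andP[? ?] := mt0 i; apply/andP; split; lra.
have [a a0 loc] := contact_localized l0 DO phiz.
set rho := l / (16 * d.+1%:R) in loc.
have rho0 : 0 < rho by rewrite divr_gt0// mulr_gt0.
have rhol : d.+1%:R * (16 * rho) = l.
  by rewrite /rho; move: d1; move: (d.+1%:R : R) => D D1; field; rewrite gt_eqF//; lra.
exists (fun x y : d.-tuple (measurableTypeR R) => box z rho (of_real_coords y) /\
  contact phi (box z l) a (of_real_coords y) (of_real_coords x)).
split.
- exists (fun i => rcoord z i - rho) => y yb.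
  have Yy : box z rho (of_real_coords y).
    move=> i; rewrite rcoord_of_real_coords ler_distl; have /= /andP[h1 h2] := yb i.
    have kl : (8 * d.+1%:R)^-1 * l = 2 * rho.
      by rewrite -rhol; move: d1; move: (d.+1%:R : R) => D D1; field; rewrite gt_eqF//; lra.
    by rewrite kl in h2; apply/andP; split; lra.
  have [x cx] := @contact_exists _ _ _ _ phi_psh.1 z l a (of_real_coords y) (ltW l0) DO phiz.
  exists [tuple rcoord x i | i < d]; last by rewrite of_real_coords_rcoord.
  move=> i; rewrite tnth_mktuple.
  have := loc _ _ Yy cx i; rewrite ler_distl => /andP[? ?].
  by have /andP[? ?] := zc i; apply/andP; split; lra.
- move=> x y x' y' h [Yy cx] [Yy' cx'] xh i.
  have h0 : 0 <= h := le_trans (normr_ge0 _) (xh i).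
  (* The disc on which the mean value inequality is used lies in the box. *)
  have disc (p q : R) : p ^+ 2 + q ^+ 2 <= 16^-1 ->
      box z l (of_real_coords x + cplx p q *: (of_real_coords y - of_real_coords y')).
    move=> pq j; rewrite rcoordD.
    set sv := _ *: _.
    have svl : `|rcoord sv j| <= l / 4.
      apply: ler_abs_sqr; first by rewrite divr_ge0// ltW.
      apply: le_trans (sqr_rcoord_le _ _) _; rewrite rdotZZ.
      have yy := box_dist2 Yy Yy'.
      apply: (@le_trans _ _ (16^-1 * (d%:R * (2 * rho) ^+ 2))).
        by apply: ler_pM => //; [rewrite addr_ge0 ?sqr_ge0|exact: rdot_ge0].
      have := natr_le_sqr_succ d (sqr_ge0 rho).
      have := sqr_ge0 (d.+1%:R * rho).
      by rewrite -rhol; move: (d.+1%:R : R) (d%:R : R) => D D'; lra.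
    have := loc _ _ Yy cx j; rewrite addrAC => xj.
    by apply: (le_trans (ler_normD _ _)); lra.
  have lip := contact_lipschitz phi_psh DO a0 cx cx' disc.
  have xx : dist2 (of_real_coords x) (of_real_coords x') <= d%:R * h ^+ 2.
    by apply: rdot_le_bound => j; rewrite rcoordB !rcoord_of_real_coords.
  apply: ler_abs_sqr; first by rewrite !mulr_ge0.
  have := sqr_rcoord_le (of_real_coords y - of_real_coords y') i.
  rewrite rcoordB !rcoord_of_real_coords => /le_trans; apply; apply: (le_trans lip).
  have := natr_le_sqr_succ d (sqr_ge0 h).
  by move: (d.+1%:R : R) (d%:R : R) xx => D D'; lra.
- move=> w lim [_ nw _]; apply: nw.
  have [|y Yy cw] := @contact_limit _ _ _ _ phi_psh.1 z l a (box z rho) (of_real_coords w)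
    (ltW l0) DO phiz a0 (@box_compact _ _ z rho).
    move=> e e0; have [x [y [[Yy cxy] xw]]] := lim _ e0.
    exists (of_real_coords x), (of_real_coords y); split => // i.
    by rewrite !rcoord_of_real_coords.
  apply: (contact_allows DO _ (loc _ _ Yy cw) cw).
  by lra.
Qed.

End assembly.

Unset Implicit Arguments.
Set Strict Implicit.

Theorem theorem29 (R : realType) (n : nat) (Omega : set 'CC[R]_n)
    (phi : 'CC[R]_n -> \bar R)
    (Omega_domain : domain Omega) (phi_psh : plurisubharmonic_on Omega phi) :
  almost_every (fun z : 'CC[R]_n =>
    Omega z -> allows_differential_test_from_above Omega phi z).
Proof.
have [oO _ _] := Omega_domain.
rewrite /almost_every /almost_everywhere.
apply: (@negligibleS _ _ _ _ (\bigcup_k exceptional Omega phi k)).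
  move=> t /= /not_implyP[Ot nt].
  have /nbhs_rcoordP[e e0 eO] : nbhs (of_real_coords t) Omega by exact: open_nbhs_nbhs.
  have [k ke] : exists k : nat, k.+1%:R^-1 < e.
    exists (Num.truncn e^-1); rewrite invf_plt ?posrE//.
    by have /andP[_ ->] := truncn_itv (ltW (introT idP (etrans (invr_gt0 e) e0))).
  exists k => //; split => // x tx; apply: eO => i; exact: le_lt_trans (tx i) ke.
apply: negligible_bigcup => k.
have d1 : 1 <= (n + n).+1%:R :> R by rewrite ler1n.
apply: (porous_negligible _ _ _ (@exceptional_porous _ _ _ _ phi_psh k)).
- rewrite invr_gt0 mulr_gt0//= invf_le1 ?mulr_gt0//; lra.
- by lra.
- by rewrite divr_gt0// invr_gt0.
Qed.
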